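(* Let $n\in\mathbb{N}$ and let $A:\mathbb{R}_+\to\mathbb{R}^{n\times n}$ be measurable and bounded. Let $\nu(t)=e^{-at}$ with $a>0$, and suppose that $$\sup_{t\in\mathbb{R}_+}\int_0^t\frac{\nu(t)}{\nu(s)}\|A(s)\|\,ds=q<1,$$ a condition which is satisfied, for example, if $a>\|A(\cdot)\|_{L_\infty}$. Then for every $\zeta(\cdot)\in C_0(\mathbb{R}_+,\mathbb{R}^n;\nu)$ there exists a uniquely determined $x(\cdot)\in C_0(\mathbb{R}_+,\mathbb{R}^n;\nu)$ such that $$\zeta(t)=x(t)-\int_0^t A(s)x(s)\,ds\qquad\text{for all } t\in\mathbb{R}_+.$$
   Context: $\mathbb{R}_+=[0,\infty)$. For $\nu(t)=e^{-at}$, $a>0$, $C_0(\mathbb{R}_+,\mathbb{R}^n;\nu)$ denotes the space of continuous functions $x:\mathbb{R}_+\to\mathbb{R}^n$ with $\lim_{t\to\infty}\nu(t)x(t)=0$, equipped with the norm $\|x(\cdot)\|_{\infty,\nu}=\sup_{t\in\mathbb{R}_+}\nu(t)\|x(t)\|$. $\|A(s)\|$ is the operator norm induced by the norm on $\mathbb{R}^n$ and $\|A(\cdot)\|_{L_\infty}$ is the essential supremum of $\|A(s)\|$ over $s\in\mathbb{R}_+$. *)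

(* Defs.v *)
From HB Require Import structures.
From mathcomp Require Import all_boot all_order all_algebra.
From mathcomp Require Import all_classical all_reals all_analysis ess_sup_inf.

Set Implicit Arguments.
Unset Strict Implicit.
Unset Printing Implicit Defensive.

Import Order.TTheory GRing.Theory Num.Theory.
Import numFieldNormedType.Exports.

Local Open Scope classical_set_scope.
Local Open Scope ring_scope.

(* The real line with the sigma-algebra of Lebesgue measurable sets (not only
   the Borel sets), on which [completed_lebesgue_measure] is defined. *)
Notation lebesgueType R := (caratheodory_type (@wlength R idfun)^*%mu).

Section defs.
Context {R : realType}.
Local Notation lebesgueType := (lebesgueType R).

Definition leb : {measure set lebesgueType -> \bar R} :=
  @completed_lebesgue_measure R.

Definition Rplus : set R := `[0, +oo[.

(* Functions on [Rplus] are represented by functions on R whose values outside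
   [Rplus] are irrelevant. *)

Definition is_norm n (N : 'cV[R]_n -> R) : Prop :=
  [/\ forall u v, N (u + v) <= N u + N v,
      forall (c : R) v, N (c *: v) = `|c| * N v
    & forall v, N v = 0 -> v = 0].

(* The supremum is over [N v <= 1] and not [N v = 1], so that the set is never
   empty, even for n = 0. *)
Definition opnorm n (N : 'cV[R]_n -> R) (B : 'M[R]_n) : R :=
  sup [set N (B *m v) | v in [set v | N v <= 1]].

Definition measurable_mx n (A : R -> 'M[R]_n) : Prop :=
  forall i j,
    measurable_fun (Rplus : set lebesgueType) (fun s : lebesgueType => A s i j).

Definition bounded_mx n (N : 'cV[R]_n -> R) (A : R -> 'M[R]_n) : Prop :=
  exists M : R, forall s, Rplus s -> opnorm N (A s) <= M.

(* The restriction extends by 0 outside [Rplus], which does not affect the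
   essential supremum of a nonnegative function. *)
Definition Linfty_norm n (N : 'cV[R]_n -> R) (A : R -> 'M[R]_n) : \bar R :=
  ess_sup leb
    ((fun s : lebesgueType => (opnorm N (A s))%:E) \_ (Rplus : set lebesgueType)).

Definition exp_weight (a : R) (t : R) : R := expR (- (a * t)).

(* The topology on 'cV[R]_n is the product topology, which is the topology of
   any norm. *)
Definition C0 n (nu : R -> R) (x : R -> 'cV[R]_n) : Prop :=
  {within Rplus, continuous x} /\ nu t *: x t @[t --> +oo] --> (0 : 'cV[R]_n).

Definition weighted_sup n (N : 'cV[R]_n -> R) (nu : R -> R) (A : R -> 'M[R]_n)
    : \bar R :=
  ereal_sup [set (\int[leb]_(s in (`[0%R, t]%classic : set lebesgueType))
                    (nu t / nu s * opnorm N (A s))%:E)%E | t in Rplus].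

Definition vintegral n (f : R -> 'cV[R]_n) (t : R) : 'cV[R]_n :=
  \col_i Rintegral leb (`[0, t]%classic : set lebesgueType) (fun s => f s i 0).

Definition solves n (A : R -> 'M[R]_n) (zeta x : R -> 'cV[R]_n) : Prop :=
  forall t, Rplus t -> zeta t = x t - vintegral (fun s => A s *m x s) t.

End defs.
Arguments Rplus R : clear implicits.

(* Main.v *)
Require Import Defs.
From mathcomp Require Import all_boot all_order all_algebra.
From mathcomp Require Import all_classical all_reals all_analysis.
From mathcomp Require Import measurable_realfun ess_sup_inf.
From mathcomp Require Import ring lra.

(** The equation says that x is a fixed point of F x = zeta + T x, where
    (T x)(t) is the integral of A x over [0, t].  With the weighted norm
    ||x|| = sup of nu(t) N(x(t)), the bound
      nu(t) N((T x)(t)) <= int_0^t nu(t)/nu(s) ||A(s)|| nu(s) N(x(s)) ds <= q ||x||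
    makes F a contraction of C0, so the result is an instance of Banach's
    fixed point theorem; the iterates and their limit are handled directly
    ([weighted_contraction_fixpoint]), since the differences of successive
    iterates decrease geometrically in the weighted norm, hence pointwise, and
    locally uniformly because nu is bounded below on bounded intervals.

    The first inequality above needs that the norm of an integral is at most the
    integral of the norm, for an arbitrary norm N.  A linear functional phi <= N
    that agrees with N at the integral ([supporting_functional], a
    finite-dimensional Hahn-Banach theorem) reduces it to the scalar function phi (A x).  The latter is compared
    with ||A(s)|| by [le_integral_dominated], which avoids the question whether
    s |-> ||A(s)|| is measurable: the integral of a nonnegative function is a
    supremum over the simple functions below it, so it is monotone in any case.
    Together they give [sublinear_vint_le] and the estimate [weighted_vint_le].

    That T maps C0 to itself ([C0_vintegral]) comes from splitting the integral
    at a time after which nu(s) N(x(s)) is small: the part before is a constant,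
    killed by nu(t) -> 0, and the part after is small by the same estimate.

    Finally, if ||A(s)|| <= m < a almost everywhere, then
    int_0^t exp(-a(t-s)) ||A(s)|| ds <= (m/a)(1 - exp(-at)) <= m/a < 1
    ([weighted_sup_lt1]). *)

Set Implicit Arguments.
Unset Strict Implicit.
Unset Printing Implicit Defensive.

Import Order.TTheory GRing.Theory Num.Theory.
Import numFieldNormedType.Exports.

Local Open Scope classical_set_scope.
Local Open Scope ring_scope.

(** * Norms on column vectors *)

Section Norms.
Context {R : realType} {n : nat} (N : 'cV[R]_n -> R).
Context (hN : is_norm N).

Lemma is_norm0 : N 0 = 0.
Proof. by case: hN => _ NZ _; rewrite -(scale0r 0) NZ normr0 mul0r. Qed.

Lemma is_normN v : N (- v) = N v.
Proof. by case: hN => _ NZ _; rewrite -scaleN1r NZ normrN1 mul1r. Qed.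

Lemma is_norm_ge0 v : 0 <= N v.
Proof.
case: hN => ND _ _; have := ND v (- v).
by rewrite subrr is_norm0 is_normN; lra.
Qed.

Lemma col_decomp (v : 'cV[R]_n) : v = \sum_i v i 0 *: delta_mx i 0.
Proof.
rewrite [LHS]matrix_sum_delta; apply: eq_bigr => i _.
by rewrite big_ord1.
Qed.

Lemma is_norm_sum (I : Type) (r : seq I) (f : I -> 'cV[R]_n) :
  N (\sum_(i <- r) f i) <= \sum_(i <- r) N (f i).
Proof.
elim: r => [|i r ih]; first by rewrite !big_nil is_norm0.
rewrite !big_cons; case: hN => ND _ _.
by rewrite (le_trans (ND _ _))// lerD2l.
Qed.

Lemma entry_le_norm (m p : nat) (B : 'M[R]_(m, p)) i j : `|B i j| <= `|B|.
Proof.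
rewrite [leRHS]/Num.norm/= mx_normrE; apply/bigmax_geP; right => /=.
by exists (i, j).
Qed.

Lemma mx_norm_le (m p : nat) (B : 'M[R]_(m, p)) (c : R) :
  0 <= c -> (forall i j, `|B i j| <= c) -> `|B| <= c.
Proof.
by move=> c0 Bc; rewrite [leLHS]/Num.norm/= mx_normrE bigmax_le// => -[i j] _ /=.
Qed.

Lemma is_norm_le_mx_norm : exists2 c : R, 0 < c & forall v, N v <= c * `|v|.
Proof.
exists (1 + \sum_(i < n) N (delta_mx i 0)).
  by rewrite ltr_wpDr// sumr_ge0// => i _; exact: is_norm_ge0.
move=> v; rewrite {1}(col_decomp v) (le_trans (is_norm_sum _ _))//.
rewrite mulrDl mul1r mulr_suml ler_wpDl// ler_sum// => i _.
case: hN => _ NZ _; rewrite NZ mulrC ler_wpM2l ?is_norm_ge0//.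
exact: entry_le_norm.
Qed.

(** Only this direction of the equivalence of norms needs compactness: N is
    continuous, so it attains a minimum on the unit sphere of the sup norm, and
    the minimum is positive because N vanishes only at 0.  The sphere is taken
    among row vectors, to which [bounded_closed_compact] applies. *)
Lemma mx_norm_le_is_norm : exists2 c : R, 0 < c & forall v, `|v| <= c * N v.
Proof.
have [c c0 Nc] := is_norm_le_mx_norm.
have ND := let: And3 h _ _ := hN in h.
have NZ := let: And3 _ h _ := hN in h.
have N0 := let: And3 _ _ h := hN in h.
have trnorm (u : 'rV[R]_n) : `|u^T| = `|u|.
  apply/eqP; rewrite eq_le; apply/andP; split; apply: mx_norm_le => // i j.
    by rewrite mxE entry_le_norm.
  by rewrite (_ : u i j = u^T j i) ?entry_le_norm// mxE.
pose S : set 'rV[R]_n := [set u | `|u| = 1].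
have cN : continuous (fun u : 'rV[R]_n => N u^T).
  move=> u; apply/(@cvgrPdist_le _ R^o _ (nbhs u)) => e e0; near=> w.
  have Nle (x y : 'cV[R]_n) : N x - N y <= N (x - y).
    by rewrite lerBlDr (le_trans _ (ND _ _))// subrK.
  apply: (@le_trans _ _ (N (u^T - w^T))).
    by rewrite ler_norml Nle andbT lerNl opprB -[N (_ - _)]is_normN opprB Nle.
  rewrite (le_trans (Nc _))// -linearB/= trnorm -ler_pdivlMl//.
  near: w; have /cvgrPdist_le := @cvg_id _ (nbhs u); apply.
  by rewrite mulr_gt0// invr_gt0.
have cS : compact S.
  apply: bounded_closed_compact.
    by exists 1; split => // x x1 u /= ->; exact: ltW.
  rewrite (_ : S = (fun u : 'rV[R]_n => `|u|) @^-1` [set 1])//.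
  apply: (closed_comp (fun u _ => @norm_continuous _ _ u)).
  exact: closed_eq.
(* The sphere is empty exactly in dimension 0, where the only vector is 0. *)
have [S0|Sn0] := pselect (S !=set0); last first.
  exists 1 => // v; rewrite mul1r.
  have [->|v0] := eqVneq v 0; first by rewrite normr0 is_norm0.
  exfalso; apply: Sn0; exists (`|v|^-1 *: v^T); rewrite /S/= normrZ.
  rewrite -trnorm trmxK ger0_norm ?invr_ge0// mulVf//.
  by rewrite normr_eq0.
have [u Su umin] := EVT_min_rV S0 cS (continuous_subspaceT cN).
have Nu0 : 0 < N u^T.
  rewrite lt_neqAle is_norm_ge0 andbT eq_sym; apply/eqP => /N0 u0.
  by move: Su; rewrite inE /S/= -trnorm u0 normr0 => /eqP; rewrite eq_sym oner_eq0.
exists (N u^T)^-1; first by rewrite invr_gt0.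
move=> v; have [->|v0] := eqVneq v 0; first by rewrite normr0 is_norm0 mulr0.
have nv0 : 0 < `|v| by rewrite normr_gt0.
rewrite ler_pdivlMl// mulrC -ler_pdivlMl//.
have := umin (`|v|^-1 *: v^T); rewrite inE /S/= normrZ -trnorm trmxK.
rewrite ger0_norm ?invr_ge0// mulVf ?gt_eqF// => /(_ erefl).
by rewrite linearZ/= trmxK NZ ger0_norm ?invr_ge0.
Unshelve. all: end_near.
Qed.

(** The operator norm is a supremum in R, which carries information only once
    the set is known to be bounded; this follows by comparing N with the sup
    norm in both directions. *)
Lemma opnorm_has_sup (B : 'M[R]_n) :
  has_sup [set N (B *m v) | v in [set v | N v <= 1]].
Proof.
split; first by exists (N (B *m 0)); exists 0 => //=; rewrite is_norm0.
have [c c0 Nc] := is_norm_le_mx_norm.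
have [d d0 Nd] := mx_norm_le_is_norm.
exists (c * (\sum_(j < n) `|B| * d)) => _ [v /= Nv1 <-].
rewrite (le_trans (Nc _))// ler_wpM2l ?(ltW c0)//.
apply: mx_norm_le => [|i j]; first by rewrite sumr_ge0// => j _; rewrite mulr_ge0// ltW.
rewrite mxE (le_trans (ler_norm_sum _ _ _))// ler_sum// => k _.
rewrite normrM ler_pM ?entry_le_norm// (le_trans (entry_le_norm _ _ _))//.
by rewrite (le_trans (Nd _))// ler_piMr// ltW.
Qed.

Lemma opnorm_ge0 (B : 'M[R]_n) : 0 <= opnorm N B.
Proof.
rewrite -is_norm0 -(mulmx0 _ B) /opnorm; apply: ub_le_sup => /=.
  by case: (opnorm_has_sup B).
by exists 0; rewrite //= is_norm0.
Qed.

Lemma opnorm_mulmx (B : 'M[R]_n) v : N (B *m v) <= opnorm N B * N v.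
Proof.
have NZ := let: And3 _ h _ := hN in h.
have N0 := let: And3 _ _ h := hN in h.
have [Nv0|Nv0] := eqVneq (N v) 0.
  by rewrite (N0 _ Nv0) mulmx0 is_norm0 mulr0.
have Nv_gt0 : 0 < N v by rewrite lt_neqAle eq_sym Nv0 is_norm_ge0.
rewrite mulrC -ler_pdivrMl//.
have := NZ (N v)^-1 (B *m v); rewrite ger0_norm ?invr_ge0 ?is_norm_ge0// => <-.
rewrite scalemxAr; apply: ub_le_sup; first by case: (opnorm_has_sup B).
exists ((N v)^-1 *: v) => //=.
by rewrite NZ ger0_norm ?invr_ge0 ?is_norm_ge0// mulVf.
Qed.

End Norms.

(** * Supporting functionals of sublinear functions *)

Section Supporting.
Context {R : realType} {V : lmodType R}.

Definition sublinear (p : V -> R) : Prop :=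
  (forall u v, p (u + v) <= p u + p v) /\
  (forall c v, 0 <= c -> p (c *: v) <= c * p v).

Lemma sublinear0 p : sublinear p -> p 0 = 0.
Proof.
move=> [pD pZ]; have := pZ 0 0 (lexx _); have := pD 0 0.
by rewrite scale0r addr0; lra.
Qed.

Lemma sublinear_oppge p v : sublinear p -> - p v <= p (- v).
Proof.
by move=> sp; have := sp.1 v (- v); rewrite subrr sublinear0//; lra.
Qed.

(** For sublinear p one always has - p v <= p (- v), so this says that p is
    linear on the line spanned by v. *)
Definition flat (p : V -> R) (v : V) : Prop := p (- v) <= - p v.

(** Making a sublinear function smaller keeps the directions along which it is
    linear, together with its values there; so directions can be treated one
    after the other. *)
Lemma flat_le p q v : sublinear q -> (forall w, q w <= p w) ->
  flat p v -> flat q v /\ q v = p v.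
Proof.
move=> sq qp pv; have := sublinear_oppge v sq.
have := qp v; have := qp (- v); rewrite /flat in pv *; split; lra.
Qed.

(** The function q v = inf over t >= 0 of p (v + t e) - t p e does it: t = 0
    gives q <= p, and t = 1 at v = - e gives the last bound, which also forces
    q e = p e.  This is the extension step of the Hahn-Banach theorem in a form
    that needs no subspaces. *)
Lemma sublinear_flatten p e : sublinear p ->
  exists q, [/\ sublinear q, forall v, q v <= p v & q (- e) <= - p e].
Proof.
move=> sp; have [pD pZ] := sp.
pose S v : set R := [set p (v + t *: e) - t * p e | t in [set t | 0 <= t]].
have lbS v : lbound (S v) (- p (- v)).
  move=> _ [t /= t0 <-].
  have := pD (v + t *: e) (- v); rewrite addrAC subrr add0r.
  have := pZ t (- e) t0; have := pZ t e t0.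
  have tinv : t * p e <= p (t *: e).
    have [->|tn0] := eqVneq t 0; first by rewrite mul0r scale0r sublinear0.
    have tp : 0 < t by rewrite lt_neqAle eq_sym tn0.
    have := pZ t^-1 (t *: e); rewrite invr_ge0 scalerA mulVf// scale1r.
    by move=> /(_ t0); rewrite ler_pdivlMl.
  by move: tinv; lra.
have hS v : has_inf (S v).
  split; last by exists (- p (- v)).
  by exists (p (v + 0 *: e) - 0 * p e); exists 0 => //=.
have leS v t : 0 <= t -> inf (S v) <= p (v + t *: e) - t * p e.
  by move=> t0; apply: ge_inf; [exact: (hS v).2|exists t].
have qle v : inf (S v) <= p v.
  by have := leS v 0 (lexx _); rewrite scale0r addr0 mul0r subr0.
exists (fun v => inf (S v)); split => //.
- split=> [u v|c v c0].
  + rewrite -lerBlDr; apply: lb_le_inf => [|_ [t /= t0 <-]]; first exact: (hS u).1.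
    rewrite lerBlDr -lerBlDl; apply: lb_le_inf => [|_ [s /= s0 <-]].
      exact: (hS v).1.
    have := leS (u + v) (t + s) (addr_ge0 t0 s0).
    rewrite scalerDl addrACA; have := pD (u + t *: e) (v + s *: e); lra.
  + have [->|cn0] := eqVneq c 0.
      by rewrite scale0r mul0r -(sublinear0 sp) qle.
    have cp : 0 < c by rewrite lt_neqAle eq_sym cn0.
    rewrite -ler_pdivrMl//; apply: lb_le_inf => [|_ [t /= t0 <-]].
      exact: (hS v).1.
    rewrite ler_pdivrMl//.
    have := leS (c *: v) (c * t) (mulr_ge0 c0 t0).
    rewrite -scalerA -scalerDr; have := pZ c (v + t *: e) c0; lra.
- have := leS (- e) 1 ler01.
  by rewrite scale1r addNr mul1r sublinear0// sub0r.
Qed.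

Lemma sublinear_flatten_seq p (s : seq V) : sublinear p ->
  exists q, [/\ sublinear q, forall v, q v <= p v
              & forall e, e \in s -> flat q e].
Proof.
move=> sp; elim: s => [|e s [q [sq qp qs]]]; first by exists p; split.
have [r [sr rq re]] := sublinear_flatten e sq.
exists r; split=> // [v|f]; first exact: le_trans (rq v) (qp v).
rewrite inE => /predU1P[->|fs].
  by rewrite /flat (le_trans re)// lerN2.
by have [] := flat_le sr rq (qs _ fs).
Qed.

End Supporting.

(** Flattening p along v0 fixes the value at v0; flattening along all basis
    vectors then gives r <= p that is odd on the basis.  The linear function phi
    with the same values on the basis satisfies r <= phi by subadditivity, and
    applying this to - v gives phi v <= - r (- v) <= r v.  So phi = r. *)
Lemma supporting_functional {R : realType} {n : nat} (p : 'cV[R]_n -> R) v0 :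
  sublinear p ->
  exists2 w : 'I_n -> R, forall v : 'cV[R]_n, \sum_i w i * v i 0 <= p v
                       & p v0 = \sum_i w i * v0 i 0.
Proof.
move=> sp; have [q [sq qp qv0]] := sublinear_flatten v0 sp.
have [r [sr rq rflat]] :=
  sublinear_flatten_seq [seq (delta_mx i 0 : 'cV[R]_n) | i : 'I_n] sq.
pose phi (v : 'cV[R]_n) := \sum_i r (delta_mx i 0) * v i 0.
have phiN v : phi (- v) = - phi v.
  by rewrite /phi -sumrN; apply: eq_bigr => i _; rewrite mxE mulrN.
have rphi v : r v <= phi v.
  have rsum (I : Type) (s : seq I) (f : I -> 'cV[R]_n) :
      r (\sum_(i <- s) f i) <= \sum_(i <- s) r (f i).
    elim: s => [|i s ih]; first by rewrite !big_nil sublinear0.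
    by rewrite !big_cons (le_trans (sr.1 _ _))// lerD2l.
  rewrite {1}[v]matrix_sum_delta (le_trans (rsum _ _ _))// ler_sum// => i _.
  rewrite big_ord1 mulrC; have [v0_|v_0] := leP 0 (v i 0); first exact: sr.2.
  set d : 'cV[R]_n := delta_mx i 0.
  have -> : v i 0 *: d = (- v i 0) *: (- d) by rewrite scaleNr scalerN opprK.
  rewrite -mulrNN.
  have nv0 : 0 <= - v i 0 by rewrite oppr_ge0 ltW.
  apply: le_trans (sr.2 _ _ nv0) _; apply: ler_wpM2l => //.
  by apply: rflat; apply/mapP; exists i; rewrite ?mem_enum.
exists (fun i => r (delta_mx i 0)) => [v|]; rewrite -/(phi _).
  have := rphi (- v); rewrite phiN; have := sublinear_oppge v sr.
  by have := rq v; have := qp v; lra.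
have := rphi (- v0); rewrite phiN; have := rq (- v0).
have := sublinear_oppge v0 sr.
have := rphi v0; have := rq v0; have := qp v0.
lra.
Qed.

(** * Norms of vector-valued integrals *)

Section UpperIntegral.
Context {d : measure_display} {T : measurableType d} {R : realType}.
Context (mu : {measure set T -> \bar R}).
Local Open Scope ereal_scope.

(** Monotonicity for arbitrary functions: the integral of a nonnegative function
    is the supremum of the integrals of the simple functions below it, and every
    simple function below the positive part of h on D is below g on E. *)
Lemma le_integral_dominated (D E : set T) (h g : T -> \bar R) :
  D `<=` E -> (forall x, D x -> h x <= g x) -> (forall x, E x -> 0 <= g x) ->
  \int[mu]_(x in D) h x <= \int[mu]_(x in E) g x.
Proof.
move=> DE hg g0; rewrite integralE.
apply: (@le_trans _ _ (\int[mu]_(x in D) h^\+ x)).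
  by rewrite -[leRHS]adde0 leeD2l// oppe_le0 integral_ge0.
rewrite integral_mkcond [leRHS]integral_mkcond.
have hp0 x : 0 <= ((h^\+)%E \_ D) x by apply: erestrict_ge0.
have gE0 x : 0 <= (g \_ E) x by exact: erestrict_ge0.
rewrite !ge0_integralTE//; apply: ereal_sup_le => _ [k /= kh <-].
exists k => //= x; apply: le_trans (kh x) _.
rewrite !patchE; case: ifPn => [/set_mem Dx|_]; last exact: gE0.
by rewrite mem_set ?funeposE; [rewrite ge_max hg// g0//; exact: DE|exact: DE].
Qed.

(** The exceptional null set is absorbed by adding to g the function equal to
    +oo on it, which does not change the integral. *)
Lemma le_integral_dominated_ae (E : set T) (h g : T -> \bar R) :
  measurable E -> measurable_fun E g -> (forall x, E x -> 0 <= g x) ->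
  (\forall x \ae mu, E x -> h x <= g x) ->
  \int[mu]_(x in E) h x <= \int[mu]_(x in E) g x.
Proof.
move=> mE mg g0 [Z [mZ muZ0 hgZ]].
pose k : T -> \bar R := cst +oo \_ Z.
have mk : measurable_fun E k by apply/measurable_restrict.
have k0 x : 0 <= k x by apply: erestrict_ge0 => y _; exact: leey.
have -> : \int[mu]_(x in E) g x = \int[mu]_(x in E) (g x + k x).
  have mEZ : measurable (E `&` Z) by exact: measurableI.
  have muEZ : mu (E `&` Z) = 0 by apply: (subset_measure0 mEZ mZ).
  rewrite ge0_integralD// -integral_mkcondr [X in _ + X]null_set_integral//.
  by rewrite adde0.
apply: le_integral_dominated => // x Ex; last by rewrite adde_ge0 ?g0.
rewrite /k patchE; case: ifPn => [_|/negP xZ].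
  by rewrite addey ?leey// gt_eqF// (lt_le_trans _ (g0 x Ex)).
rewrite adde0; have [//|hg] := pselect (h x <= g x).
by exfalso; apply: xZ; rewrite inE; apply: hgZ => /= /(_ Ex).
Qed.

Definition vint n (D : set T) (f : T -> 'cV[R]_n) : 'cV[R]_n :=
  \col_i Rintegral mu D (fun s => f s i 0%R).

Definition vintegrable n (D : set T) (f : T -> 'cV[R]_n) : Prop :=
  forall i, mu.-integrable D (fun s => (f s i 0%R)%:E).

(** Jensen's inequality for sublinear p.  The supporting functional of p at the
    integral of f commutes with the integral and lies below p, hence below g,
    on the values of f. *)
Lemma sublinear_vint_le n (p : 'cV[R]_n -> R) (D E : set T)
    (f : T -> 'cV[R]_n) (g : T -> \bar R) :
  sublinear p -> measurable D -> vintegrable D f -> D `<=` E ->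
  (forall x, D x -> (p (f x))%:E <= g x) -> (forall x, E x -> 0 <= g x) ->
  (p (vint D f))%:E <= \int[mu]_(x in E) g x.
Proof.
move=> sp mD fint DE fg g0.
have [w wp ->] := supporting_functional (vint D f) sp.
rewrite -sumEFin.
have -> : \sum_(i < n) (w i * vint D f i 0%R)%:E =
    \int[mu]_(x in D) (\sum_(i < n) (w i * f x i 0%R)%:E).
  rewrite (@integral_sum _ _ _ mu D mD _ (fun i x => (w i * f x i 0%R)%:E)).
    apply: eq_bigr => i _; rewrite mxE EFinM fineK.
      by rewrite -integralZl//; exact: fint.
    by apply: integrable_fin_num => //; exact: fint.
  move=> i; under [X in _.-integrable _ X]eq_fun do rewrite EFinM.
  by apply: integrableZl => //; exact: fint.
apply: le_integral_dominated => // x Dx.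
by rewrite sumEFin (le_trans _ (fg x Dx))// lee_fin.
Qed.

Lemma vintB n (D : set T) (f g : T -> 'cV[R]_n) : measurable D ->
  vintegrable D f -> vintegrable D g ->
  (vint D (fun x => f x - g x) = vint D f - vint D g)%R.
Proof.
move=> mD fi gi; apply/colP => i; rewrite !mxE.
under eq_Rintegral do rewrite !mxE.
by rewrite RintegralB//; [exact: fi|exact: gi].
Qed.

Lemma vint_setU n (D E : set T) (f : T -> 'cV[R]_n) :
  measurable D -> measurable E -> vintegrable (D `|` E) f ->
  [disjoint D & E] -> (vint (D `|` E) f = vint D f + vint E f)%R.
Proof.
move=> mD mE fi DE; apply/colP => i; rewrite !mxE.
by rewrite Rintegral_setU//; exact: fi.
Qed.

End UpperIntegral.

Section Leb.
Context {R : realType}.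
Local Notation lebT := (lebesgueType R).

Lemma leb_measurable (X : set R) :
  measurable (X : set (measurableTypeR R)) -> measurable (X : set lebT).
Proof. by move=> mX; apply: sub_caratheodory; exact: mX. Qed.

Lemma leb_measurable_itv (i : interval R) : measurable ([set` i] : set lebT).
Proof. by apply: leb_measurable; exact: measurable_itv. Qed.

Lemma measurable_id_leb :
  measurable_fun [set: lebT] (id : lebT -> measurableTypeR R).
Proof. by move=> _ Y mY; rewrite setTI; exact: leb_measurable. Qed.

(** The completed measure and the Lebesgue measure on Borel sets are the same
    outer measure restricted to two sigma-algebras, so they agree on intervals
    by conversion. *)
Lemma leb_itv (b : bool) (s t : R) : s <= t ->
  leb ([set` Interval (BSide b s) (BRight t)] : set lebT) = (t - s)%:E.
Proof.
move=> st.
transitivity (lebesgue_measure [set` Interval (BSide b s) (BRight t)]).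
  by [].
rewrite lebesgue_measure_itv /= lte_fin -EFinB; case: ltP => // ts.
by rewrite (_ : t - s = 0)//; lra.
Qed.

Lemma continuous_leb_measurable (f : R -> R) :
  {within Rplus R, continuous f} ->
  measurable_fun (Rplus R : set lebT) (f : lebT -> R).
Proof.
move=> cf _ Y mY; apply: leb_measurable.
apply: measurable_realfun.subspace_continuous_measurable_fun cf _ _ mY => //.
all: exact: measurable_itv.
Qed.

End Leb.

(** * Locally bounded measurable functions and their primitives *)

Section Topology.
Context {R : realType} {V : normedModType R}.

Lemma within_continuous_distP (A : set R) (f : R -> V) :
  {within A, continuous f} <->
  (forall x, A x -> forall e, 0 < e -> exists2 d, 0 < d &
     forall y, A y -> `|x - y| < d -> `|f x - f y| <= e).
Proof.
split.
  move/subspace_continuousP => cf x Ax e e0.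
  have /cvgrPdist_le/(_ e e0) := cf x Ax.
  move=> [d /= d0 df]; exists d => // y Ay xy.
  by apply: df.
move=> cf; apply/subspace_continuousP => x Ax.
apply/cvgrPdist_le => e e0.
have [d d0 df] := cf x Ax e e0.
exists d => //= y xy Ay; exact: df.
Qed.

Lemma cvg_pinfty0_distP (f : R -> V) :
  f t @[t --> +oo] --> (0 : V) <->
  (forall e, 0 < e -> exists2 T, 0 <= T & forall t, T <= t -> `|f t| <= e).
Proof.
split.
  move/cvgrPdist_le => cf e e0; have [T [Treal Tf]] := cf e e0.
  exists (Num.max 0 (T + 1)); first by rewrite le_max lexx.
  move=> t; rewrite ge_max => /andP[_ Tt]; rewrite -normrN -sub0r.
  by apply: Tf; lra.
move=> cf; apply/cvgrPdist_le => e e0; have [T T0 Tf] := cf e e0.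
exists T; split; first exact: num_real.
by move=> t /ltW Tt; rewrite sub0r normrN; exact: Tf.
Qed.

End Topology.

Section LocBounded.
Context {R : realType} {n : nat}.
Local Notation lebT := (lebesgueType R).
Implicit Types f g x : R -> 'cV[R]_n.

(** A class that contains C0, is stable under multiplication by A and
    guarantees integrability on every [0, t]; A x is in general not continuous. *)
Definition loc_bounded_measurable f : Prop :=
  (forall i, measurable_fun (Rplus R : set lebT) (fun s : lebT => f s i 0)) /\
  (forall t, exists K : R, forall s, 0 <= s <= t -> `|f s| <= K).

Lemma RplusE (t : R) : Rplus R t = (0 <= t) :> Prop.
Proof. by rewrite /Rplus/= in_itv/= andbT. Qed.

Lemma continuous_loc_bounded_measurable f :
  {within Rplus R, continuous f} -> loc_bounded_measurable f.
Proof.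
move=> cf; split=> [i|t].
  apply: continuous_leb_measurable.
  apply/(@within_continuous_distP R R^o) => x Ax e e0.
  have [d d0 df] := (within_continuous_distP _ _).1 cf x Ax e e0.
  exists d => // y Ay xy; apply: le_trans (df y Ay xy).
  by have := entry_le_norm (f x - f y) i 0; rewrite !mxE.
have [t0|t0] := leP 0 t; last by exists 0 => s /andP[? ?]; exfalso; lra.
have cnf : {within `[0, t], continuous (fun s => `|f s|)}.
  apply/(@within_continuous_distP R R^o) => x; rewrite /= in_itv/= => /andP[x0 xt] e e0.
  have Rx : Rplus R x by rewrite RplusE.
  have [d d0 df] := (within_continuous_distP _ _).1 cf x Rx e e0.
  exists d => // y /=; rewrite in_itv/= => /andP[y0 yt] xy.
  by rewrite (le_trans (ler_dist_dist _ _))// df// RplusE.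
have [c _ cmax] := EVT_max t0 cnf.
by exists `|f c| => s st; apply: cmax; rewrite in_itv.
Qed.

Lemma loc_bounded_measurableB f g :
  loc_bounded_measurable f -> loc_bounded_measurable g ->
  loc_bounded_measurable (fun s => f s - g s).
Proof.
move=> [mf bf] [mg bg]; split=> [i|t].
  under eq_fun do rewrite !mxE.
  by apply: measurable_funB; [exact: mf|exact: mg].
have [K fK] := bf t; have [L gL] := bg t.
exists (K + L) => s st; rewrite (le_trans (ler_normB _ _))//.
by rewrite lerD ?fK ?gL.
Qed.

Lemma loc_bounded_measurable_integrable f (t : R) (D : set lebT) :
  loc_bounded_measurable f -> measurable D -> D `<=` `[0, t] ->
  vintegrable (leb : {measure set lebT -> \bar R}) D f.
Proof.
move=> [mf bf] mD Dt i; have [t0|t0] := leP 0 t; last first.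
  rewrite (_ : D = set0); first exact: integrable_set0.
  by rewrite -subset0 => s /Dt/=; rewrite in_itv/= => /andP[? ?]; lra.
apply: (@integrableS _ _ _ _ (`[0, t]%classic : set lebT)) => //.
  exact: leb_measurable_itv.
apply: (@measurable_bounded_integrable _ lebT R leb).
- exact: leb_measurable_itv.
- by rewrite leb_itv// ltry.
- apply: measurable_funS (mf i); first exact: leb_measurable_itv.
  by move=> s /=; rewrite in_itv/= RplusE => /andP[].
- have [K fK] := bf t; exists K; split; first exact: num_real.
  move=> L KL s /=; rewrite in_itv/= => st.
  by rewrite (le_trans (entry_le_norm _ _ _))// (le_trans (fK _ st))// ltW.
Qed.

Lemma vintegral_itv f (s t : R) : loc_bounded_measurable f -> 0 <= s <= t ->
  vintegral f t = vintegral f s + vint leb (`]s, t]%classic : set lebT) f.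
Proof.
move=> lf /andP[s0 st].
rewrite -[vintegral f s]/(vint leb (`[0, s]%classic : set lebT) f).
rewrite -[vintegral f t]/(vint leb (`[0, t]%classic : set lebT) f).
have E : `[0, t]%classic = `[0, s]%classic `|` `]s, t]%classic.
  by apply: itv_bndbnd_setU; rewrite bnd_simp.
rewrite E vint_setU//; try exact: leb_measurable_itv.
  rewrite -E; apply: (loc_bounded_measurable_integrable (t := t)) => //.
  exact: leb_measurable_itv.
apply/disj_setPS => y [/=]; rewrite !in_itv/= => /andP[_ ys] /andP[sy _].
by move: sy; rewrite ltNge ys.
Qed.

Lemma norm_vint_le f (s t K : R) : loc_bounded_measurable f ->
  0 <= s <= t -> (forall u, s < u <= t -> `|f u| <= K) -> 0 <= K ->
  `|vint leb (`]s, t]%classic : set lebT) f| <= K * (t - s).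
Proof.
move=> lf /andP[s0 st] fK K0; rewrite -lee_fin.
have sn : sublinear (fun v : 'cV[R]_n => `|v|).
  split=> [u v|c v c0]; first exact: ler_normD.
  by rewrite normrZ ger0_norm.
rewrite EFinM -(leb_itv false st).
rewrite -integral_cst; last exact: leb_measurable_itv.
apply: (sublinear_vint_le sn) => //.
- exact: leb_measurable_itv.
- apply: (loc_bounded_measurable_integrable (t := t)) => //.
    exact: leb_measurable_itv.
  by move=> y /=; rewrite !in_itv/= => /andP[/ltW/(le_trans s0)-> ->].
Qed.

Lemma vintegral_continuous f : loc_bounded_measurable f ->
  {within Rplus R, continuous (vintegral f)}.
Proof.
move=> lf; apply/within_continuous_distP => x; rewrite RplusE => x0 e e0.
have [K0 fK0] := lf.2 (x + 1).
(* K bounds f on [0, x + 1] and is positive, so that e / K makes sense. *)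
pose K := Num.max 1 K0.
have K_gt0 : 0 < K by rewrite lt_max ltr01.
have fK s : 0 <= s <= x + 1 -> `|f s| <= K.
  by move=> sx; rewrite le_max fK0// orbT.
exists (Num.min 1 (e / K)); first by rewrite lt_min ltr01 divr_gt0.
have main s t : 0 <= s <= t -> t <= x + 1 -> t - s < e / K ->
    `|vintegral f t - vintegral f s| <= e.
  move=> /andP[s0 st] tx ts; rewrite (vintegral_itv lf (s := s)) ?s0// addrC addKr.
  apply: le_trans (norm_vint_le (K := K) lf _ _ (ltW K_gt0)) _; rewrite ?s0//.
    by move=> u /andP[su ut]; apply: fK; lra.
  by rewrite mulrC -ler_pdivlMr// ltW.
move=> y; rewrite RplusE lt_min => y0 /andP[xy1 xyK].
move: xy1 xyK; have [xy|/ltW yx] := leP x y.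
  rewrite ler0_norm ?subr_le0// opprB distrC => xy1 xyK.
  by apply: main; [rewrite x0|lra|].
rewrite ger0_norm ?subr_ge0// => xy1 xyK.
by apply: main; [rewrite y0|lra|].
Qed.

End LocBounded.

Section C0.
Context {R : realType} {n : nat}.
Implicit Types x y : R -> 'cV[R]_n.

Lemma C0_loc_bounded_measurable nu x :
  C0 nu x -> loc_bounded_measurable x.
Proof. by case=> + _; exact: continuous_loc_bounded_measurable. Qed.

Lemma C0D nu x y : C0 nu x -> C0 nu y -> C0 nu (fun t => x t + y t).
Proof.
move=> [cx x0] [cy y0]; split.
  by move=> t; apply: continuousD; [exact: (cx t)|exact: (cy t)].
rewrite (_ : (fun t => nu t *: (x t + y t)) =
    (fun t => nu t *: x t) \+ (fun t => nu t *: y t)).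
  have := cvgD x0 y0; rewrite addr0; apply.
by apply/funext => t; rewrite scalerDr.
Qed.

Lemma C0N nu x : C0 nu x -> C0 nu (fun t => - x t).
Proof.
move=> [cx x0]; split.
  by move=> t; apply: continuousN; exact: (cx t).
rewrite (_ : (fun t => nu t *: - x t) = \- (fun t => nu t *: x t)).
  have := cvgN x0; rewrite oppr0; apply.
by apply/funext => t; rewrite scalerN.
Qed.

End C0.

(** * Fixed points of contractions of the weighted space *)

(** With r k = K q^k / (1 - q), which telescopes to r k - r k.+1 = K q^k, the
    sequence u - r increases and u + r decreases, and the former stays below the
    latter.  The supremum of u - r therefore lies between them at every k. *)
Lemma geometric_increments_cvg {R : realType} (u : nat -> R) (K q : R) :
  0 <= q < 1 -> (forall k, `|u k.+1 - u k| <= K * q ^+ k) ->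
  exists l, forall k, `|l - u k| <= K / (1 - q) * q ^+ k.
Proof.
move=> /andP[q0 q1] uK.
have q1' : 0 < 1 - q by lra.
pose r k := K / (1 - q) * q ^+ k.
have rS k : r k - r k.+1 = K * q ^+ k.
  by rewrite /r exprS; field; rewrite gt_eqF.
pose a k := u k - r k; pose b k := u k + r k.
have K0 : 0 <= K by have := uK 0%N; rewrite expr0 mulr1; exact: le_trans.
have r0 k : 0 <= r k by rewrite /r mulr_ge0 ?divr_ge0 ?exprn_ge0// ltW.
have a_nd : {homo a : j k / (j <= k)%N >-> j <= k}.
  apply: homo_leq => // [x y z|k]; first exact: le_trans.
  by have := uK k; rewrite ler_norml -rS /a => /andP[]; lra.
have b_ni : {homo b : j k / (j <= k)%N >-> k <= j}.
  apply: homo_leq => // [x y z yx /le_trans|k]; first exact.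
  by have := uK k; rewrite ler_norml -rS /b => /andP[]; lra.
have ab j k : a j <= b k.
  apply: (le_trans (a_nd _ _ (leq_maxl j k))).
  apply: le_trans (b_ni _ _ (leq_maxr j k)).
  by rewrite /a /b; have := r0 (maxn j k); lra.
have hs : has_sup (range a).
  split; first by exists (a 0%N); exists 0%N.
  by exists (b 0%N) => _ [j _ <-].
exists (sup (range a)) => k; rewrite -/(r k) ler_norml.
have h1 : a k <= sup (range a) by apply: ub_le_sup; [exact: hs.2|exists k].
have h2 : sup (range a) <= b k.
  by apply: ge_sup => [|_ [j _ <-]]; [exact: hs.1|exact: ab].
by move: h1 h2; rewrite /a /b => h1 h2; apply/andP; split; lra.
Qed.

Lemma geometric_small {R : realType} (K q e : R) :
  0 <= q < 1 -> 0 < e -> exists k, K * q ^+ k <= e.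
Proof.
move=> /andP[q0 q1] e0.
have nq1 : `|q| < 1 by rewrite ger0_norm.
have /cvgrPdist_le/(_ e e0)[k _ /(_ k (leqnn _))] :=
  @cvg_geometric R K q nq1.
by rewrite /= sub0r normrN => /(le_trans (ler_norm _)); exists k.
Qed.

Section FixedPoint.
Context {R : realType} {n : nat} (N : 'cV[R]_n -> R) (nu : R -> R).
Context (hN : is_norm N) (nu_gt0 : forall t, 0 < nu t).
Context (nu_ni : {homo nu : s t / s <= t >-> t <= s}).
Implicit Types x y : R -> 'cV[R]_n.

Definition weighted_le x (C : R) : Prop :=
  forall t, 0 <= t -> nu t * N (x t) <= C.

Lemma C0_weighted_le x : C0 nu x -> exists2 C, 0 < C & weighted_le x C.
Proof.
move=> Cx; have [c c0 Nc] := is_norm_le_mx_norm hN.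
have [T T0 xT] := (cvg_pinfty0_distP _).1 Cx.2 1 ltr01.
have [K xK] := (C0_loc_bounded_measurable Cx).2 T.
have nK0 : 0 <= nu 0 * `|K| by rewrite mulr_ge0// ltW.
exists (c * (nu 0 * `|K| + 1)); first by rewrite mulr_gt0// ltr_wpDl.
move=> t t0; rewrite (le_trans (ler_wpM2l (ltW (nu_gt0 t)) (Nc _)))//.
rewrite mulrCA ler_pM2l//.
have [Tt|tT] := leP T t.
  have := xT t Tt; rewrite normrZ gtr0_norm//; lra.
rewrite ler_wpDr// ler_pM ?(ltW (nu_gt0 _))//; first exact: nu_ni.
by rewrite (le_trans (xK _ _)) ?ler_norm// t0 ltW.
Qed.

(** Uniform convergence in the weighted norm.  Near s the weight is at least
    nu (s + 1), so it gives uniform convergence on [0, s + 1] and the usual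
    three-term argument applies. *)
Lemma C0_geometric_limit (u : nat -> R -> 'cV[R]_n) x (K q : R) :
  0 <= q < 1 -> (forall k, C0 nu (u k)) ->
  (forall k t, 0 <= t -> nu t * `|x t - u k t| <= K * q ^+ k) -> C0 nu x.
Proof.
move=> q01 Cu ux; split.
  apply/within_continuous_distP => s; rewrite RplusE => s0 e e0.
  have e3 : 0 < e / 3 by lra.
  have [k ke] := geometric_small K q01 (mulr_gt0 e3 (nu_gt0 (s + 1))).
  have close t : 0 <= t -> t <= s + 1 -> `|x t - u k t| <= e / 3.
    move=> t0 ts; rewrite -(ler_pM2l (nu_gt0 (s + 1))).
    apply: (@le_trans _ _ (nu t * `|x t - u k t|)).
      by rewrite ler_wpM2r// nu_ni.
    by rewrite (le_trans (ux _ _ t0))// [leRHS]mulrC.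
  have Rs : Rplus R s by rewrite RplusE.
  have [d d0 ud] := (within_continuous_distP _ _).1 (Cu k).1 s Rs _ e3.
  exists (Num.min d 1); first by rewrite lt_min d0 ltr01.
  move=> t Rt; rewrite lt_min => /andP[std st1].
  have t0 : 0 <= t by rewrite -RplusE.
  have h1 : `|x s - u k s| <= e / 3 by apply: close => //; lra.
  have h2 : `|u k t - x t| <= e / 3.
    by rewrite distrC close//; move: st1; rewrite ltr_norml; lra.
  have h3 := ud t Rt std.
  have := ler_distD (u k s) (x s) (x t).
  have := ler_distD (u k t) (u k s) (x t).
  by move: h1 h2 h3; lra.
apply/cvg_pinfty0_distP => e e0.
have e2 : 0 < e / 2 by lra.
have [k ke] := geometric_small K q01 e2.
have [T T0 uT] := (cvg_pinfty0_distP _).1 (Cu k).2 _ e2.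
exists T => // t Tt; rewrite -(subrK (u k t) (x t)) scalerDr.
rewrite (le_trans (ler_normD _ _))// normrZ gtr0_norm//.
have := uT t Tt; have := ux k t (le_trans T0 Tt); lra.
Qed.

(** Banach's fixed point theorem for C0.  The hypothesis on F is stated on upper
    bounds C of the weighted norm rather than on the norm itself, which avoids
    suprema.  The constant q is positive so that all the bounds C q^k are. *)
Lemma weighted_contraction_fixpoint (F : (R -> 'cV[R]_n) -> R -> 'cV[R]_n)
    (q : R) x0 :
  0 < q < 1 -> C0 nu x0 -> (forall x, C0 nu x -> C0 nu (F x)) ->
  (forall x y C, C0 nu x -> C0 nu y -> 0 < C ->
     weighted_le (fun t => x t - y t) C ->
     weighted_le (fun t => F x t - F y t) (q * C)) ->
  exists x, [/\ C0 nu x, forall t, 0 <= t -> x t = F x t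
    & forall y, C0 nu y -> (forall t, 0 <= t -> y t = F y t) ->
        forall t, 0 <= t -> y t = x t].
Proof.
move=> /andP[q0 q1] Cx0 CF Fq.
have q01 : 0 <= q < 1 by rewrite ltW.
have [cl cl0 Ncl] := is_norm_le_mx_norm hN.
have [cu cu0 Ncu] := mx_norm_le_is_norm hN.
have N0 := let: And3 _ _ h := hN in h.
pose u k := iter k F x0.
have Cu k : C0 nu (u k) by elim: k => //= k; exact: CF.
have CB x y : C0 nu x -> C0 nu y -> C0 nu (fun t => x t - y t).
  by move=> Cx Cy; apply: C0D => //; exact: C0N.
have [C C_gt0 uC] := C0_weighted_le (CB _ _ (Cu 1%N) (Cu 0%N)).
have step k : weighted_le (fun t => u k.+1 t - u k t) (C * q ^+ k).
  elim: k => [|k ih]; first by rewrite expr0 mulr1.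
  rewrite exprS mulrCA; apply: (Fq (u k.+1) (u k)) => //.
  by rewrite mulr_gt0// exprn_gt0.
(* The condition 0 <= t is inside the statement so that a coordinate of the
   limit can be chosen for every real t; it is arbitrary for t < 0. *)
have lim t i : exists l, 0 <= t ->
    forall k, `|l - u k t i 0| <= cu * C / nu t / (1 - q) * q ^+ k.
  have [t0|t0] := leP 0 t; last by exists 0; lra.
  have [|l ul] := @geometric_increments_cvg R (fun k => u k t i 0)
    (cu * C / nu t) q q01; last by exists l.
  move=> k; have := step k t t0; rewrite mulrC -ler_pdivlMr// => stepk.
  have := entry_le_norm (u k.+1 t - u k t) i 0; rewrite !mxE => /le_trans; apply.
  rewrite (le_trans (Ncu _))// -!mulrA ler_pM2l// (le_trans stepk)//.
  by rewrite -mulrA [q ^+ k / _]mulrC.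
pose x t : 'cV[R]_n := \col_i xget 0 [set l | 0 <= t ->
    forall k, `|l - u k t i 0| <= cu * C / nu t / (1 - q) * q ^+ k].
pose K := cu * C / (1 - q).
have K_gt0 : 0 < K by rewrite divr_gt0 ?mulr_gt0//; lra.
have xu k t : 0 <= t -> nu t * `|x t - u k t| <= K * q ^+ k.
  move=> t0; rewrite mulrC -ler_pdivlMr//; apply: mx_norm_le => [|i j].
    by rewrite divr_ge0 ?(ltW (nu_gt0 _))// mulr_ge0 ?exprn_ge0// ltW.
  rewrite (ord1 j) !mxE; have /(xgetPex 0) := lim t i.
  move=> /(_ t0 k) /le_trans; apply.
  rewrite /K le_eqVlt; apply/orP; left; apply/eqP.
  field; rewrite (gt_eqF (nu_gt0 t))/=; lra.
have Cx : C0 nu x by apply: C0_geometric_limit xu.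
have xuN k : weighted_le (fun t => x t - u k t) (cl * K * q ^+ k).
  move=> t t0; apply: (@le_trans _ _ (cl * (nu t * `|x t - u k t|))).
    by rewrite mulrCA ler_pM2l.
  by rewrite -mulrA ler_pM2l// xu.
(* A vector whose weighted norm is below every D q^k is zero; this turns the
   estimates for the limit and for the difference of two solutions into
   equalities. *)
have zero v t (D : R) : (forall k, nu t * N v <= D * q ^+ k) -> v = 0.
  move=> vD; apply: N0; apply/eqP; rewrite eq_le is_norm_ge0// andbT.
  rewrite -(pmulr_rle0 _ (nu_gt0 t)); apply/ler_addgt0Pr => e e0; rewrite add0r.
  by have [k] := geometric_small D q01 e0; exact: le_trans.
have xF t : 0 <= t -> x t = F x t.
  move=> t0; apply/eqP; rewrite -subr_eq0; apply/eqP.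
  apply: (zero _ t (2 * (cl * K * q))) => k.
  have e1 := xuN k.+1 t t0.
  have e2 : nu t * N (u k.+1 t - F x t) <= q * (cl * K * q ^+ k).
    have clK0 : 0 < cl * K * q ^+ k by apply: mulr_gt0; [exact: mulr_gt0|exact: exprn_gt0].
    have := Fq x (u k) _ Cx (Cu k) clK0 (xuN k) t t0.
    by rewrite -is_normN// opprB.
  have ND := let: And3 h _ _ := hN in h.
  have := ND (x t - u k.+1 t) (u k.+1 t - F x t); rewrite addrA subrK.
  rewrite -(ler_pM2l (nu_gt0 t)) mulrDr; rewrite exprS in e1.
  move: e1 e2; lra.
exists x; split => // y Cy yF t t0.
have [D D0 yxD] := C0_weighted_le (CB _ _ Cy Cx).
apply/eqP; rewrite -subr_eq0; apply/eqP; apply: (zero _ t D) => k.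
suff : weighted_le (fun t => y t - x t) (D * q ^+ k) by apply.
elim: k => [|k ih]; first by rewrite expr0 mulr1.
move=> s s0; rewrite (yF s s0) (xF s s0) exprS mulrCA.
by apply: Fq => //; rewrite mulr_gt0// exprn_gt0.
Qed.

End FixedPoint.

(** * Volterra equations with a general weight *)

Section Volterra.
Context {R : realType} {n : nat} (N : 'cV[R]_n -> R) (A : R -> 'M[R]_n).
Context (hN : is_norm N) (mA : measurable_mx A) (bA : bounded_mx N A).
Local Notation lebT := (lebesgueType R).
Implicit Types x y : R -> 'cV[R]_n.

(** The entry A s i j is a coordinate of A s applied to a basis vector, so it is
    controlled by the operator norm and the equivalence of norms. *)
Lemma bounded_mx_entries :
  exists2 K, 0 <= K & forall s i j, 0 <= s -> `|A s i j| <= K.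
Proof.
have [c c0 Nc] := mx_norm_le_is_norm hN; have [M AM] := bA.
exists (c * (`|M| * \sum_(j < n) N (delta_mx j 0))).
  rewrite mulr_ge0 ?(ltW c0)// mulr_ge0// sumr_ge0// => j _.
  exact: is_norm_ge0.
move=> s i j s0; have -> : A s i j = (A s *m delta_mx j 0 : 'cV[R]_n) i 0.
  by rewrite -colE mxE.
rewrite (le_trans (entry_le_norm _ _ _))// (le_trans (Nc _))// ler_pM2l//.
rewrite (le_trans (opnorm_mulmx hN _ _))// ler_pM ?opnorm_ge0 ?is_norm_ge0//.
  by rewrite (le_trans (AM s _)) ?ler_norm// RplusE.
rewrite (bigD1 j)//= lerDl sumr_ge0// => k _; exact: is_norm_ge0.
Qed.

Lemma loc_bounded_measurable_mulmx x : loc_bounded_measurable x ->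
  loc_bounded_measurable (fun s => A s *m x s).
Proof.
move=> [mx bx]; split=> [i|t].
  under eq_fun do rewrite mxE.
  apply: (@measurable_sum _ _ _ _ _ _ (fun j (s : lebT) => A s i j * x s j 0)).
  by move=> j; apply: measurable_funM; [exact: mA|exact: mx].
have [K K0 AK] := bounded_mx_entries; have [L xL] := bx t.
exists (\sum_(j < n) K * `|L|) => s st.
have L0 : 0 <= `|L| by [].
apply: mx_norm_le => [|i j]; first by rewrite sumr_ge0// => j _; rewrite mulr_ge0.
rewrite mxE (le_trans (ler_norm_sum _ _ _))// ler_sum// => k _.
rewrite normrM ler_pM// ?AK//; first by case/andP: st.
by rewrite (le_trans (entry_le_norm _ _ _))// (le_trans (xL s st)) ?ler_norm.
Qed.

Lemma vintegral_mulmxB x y t :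
  loc_bounded_measurable x -> loc_bounded_measurable y ->
  vintegral (fun s => A s *m (x s - y s)) t =
  vintegral (fun s => A s *m x s) t - vintegral (fun s => A s *m y s) t.
Proof.
move=> lx ly; under [X in vintegral X]eq_fun do rewrite mulmxBr.
have int z : loc_bounded_measurable z ->
    vintegrable leb (`[0, t]%classic : set lebT) (fun s => A s *m z s).
  move=> /loc_bounded_measurable_mulmx lAz.
  exact: (loc_bounded_measurable_integrable lAz (leb_measurable_itv `[0, t])
    (@subset_refl _ _)).
by apply: vintB; [exact: leb_measurable_itv|exact: int|exact: int].
Qed.

Context (nu : R -> R) (nu_gt0 : forall t, 0 < nu t) (q : R).
Context (nuq : (weighted_sup N nu A <= q%:E)%E).

(** The contraction estimate, for integrals over any measurable D inside [0, t]:
    D = [0, t] is used for contraction, D = ]T, t] for the decay at infinity.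
    It is Jensen's inequality for the sublinear function (nu t / C) N, since
    N (A s x s) <= ||A s|| C / nu s on D; dividing by C puts the constant on the
    measurable side, the integrand of [weighted_sup] being left as it is. *)
Lemma weighted_vint_le x t C (D : set lebT) :
  loc_bounded_measurable x -> measurable D -> D `<=` `[0, t] -> 0 <= t ->
  0 < C -> (forall s, D s -> nu s * N (x s) <= C) ->
  nu t * N (vint leb D (fun s => A s *m x s)) <= q * C.
Proof.
move=> lx mD Dt t0 C0 xC; rewrite -ler_pdivrMr//.
have [ND NZ _] := hN.
have k0 : 0 <= nu t / C by rewrite divr_ge0// ltW.
have sp : sublinear (fun v => nu t / C * N v).
  split=> [u v|c v c0]; first by rewrite -mulrDr ler_wpM2l.
  by rewrite NZ ger0_norm// mulrCA.
rewrite mulrAC -lee_fin; apply: le_trans nuq.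
apply: (@le_trans _ _ (\int[leb]_(s in (`[0%R, t]%classic : set lebT))
    (nu t / nu s * opnorm N (A s))%:E)%E); last first.
  by apply: ereal_sup_ubound; exists t => //; rewrite RplusE.
apply: (sublinear_vint_le sp) => //.
- have lAx := loc_bounded_measurable_mulmx lx.
  exact: (loc_bounded_measurable_integrable lAx mD Dt).
- move=> s Ds; rewrite lee_fin -!mulrA ler_pM2l//.
  rewrite ler_pdivrMl// mulrA mulrAC ler_pdivlMr//.
  rewrite (le_trans _ (ler_wpM2r (opnorm_ge0 hN _) (xC s Ds)))//.
  rewrite mulrC -mulrA ler_pM2l// mulrC.
  exact: opnorm_mulmx.
- by move=> s _; rewrite lee_fin mulr_ge0 ?opnorm_ge0// divr_ge0// ltW.
Qed.

Context (nu_0 : forall e, 0 < e -> exists T, forall t, T <= t -> nu t <= e).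

(** T is chosen so that nu s N (x s) <= d for s >= T, and S so that the constant
    vector v T contributes at most d for t >= S; the integral over ]T, t]
    contributes at most q d <= d.  The factor 1 / cu in d converts back from N
    to the sup norm. *)
Lemma C0_vintegral x : 0 <= q <= 1 -> C0 nu x ->
  C0 nu (vintegral (fun s => A s *m x s)).
Proof.
move=> /andP[q0 q1] Cx; have lx := C0_loc_bounded_measurable Cx.
have lAx := loc_bounded_measurable_mulmx lx.
split; first exact: vintegral_continuous.
apply/cvg_pinfty0_distP => e e0.
have [cl cl0 Ncl] := is_norm_le_mx_norm hN.
have [cu cu0 Ncu] := mx_norm_le_is_norm hN.
have [ND _ _] := hN.
have d0 : 0 < e / cu / 2 by rewrite !divr_gt0.
set d := e / cu / 2 in d0.
have [T T0 xT] := (cvg_pinfty0_distP _).1 Cx.2 _ (divr_gt0 d0 cl0).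
set v := vintegral _.
(* The 1 avoids a division by zero when v T = 0. *)
have Nv1 : 0 < N (v T) + 1 by rewrite ltr_wpDl ?is_norm_ge0.
have [S nuS] := nu_0 (divr_gt0 d0 Nv1).
exists (Num.max T S); first by rewrite le_max T0.
move=> t; rewrite ge_max => /andP[Tt St].
rewrite normrZ gtr0_norm//.
apply: (@le_trans _ _ (cu * (nu t * N (v t)))).
  by rewrite mulrCA ler_pM2l.
rewrite mulrC -ler_pdivlMr// /v (vintegral_itv lAx (s := T)) ?T0// -/(v T).
apply: (le_trans (ler_wpM2l (ltW (nu_gt0 t)) (ND _ _))); rewrite mulrDr.
have h1 : nu t * N (v T) <= d.
  have := nuS t St; rewrite ler_pdivlMr// mulrDr mulr1.
  by have := nu_gt0 t; lra.
have h2 : nu t * N (vint leb (`]T, t]%classic : set lebT) (fun s => A s *m x s))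
    <= q * d.
  apply: weighted_vint_le => //.
  - exact: leb_measurable_itv.
  - by move=> s /=; rewrite !in_itv/= => /andP[/ltW/(le_trans T0)-> ->].
  - exact: le_trans Tt.
  - move=> s /=; rewrite in_itv/= => /andP[/ltW Ts _].
    have := xT s Ts; rewrite normrZ gtr0_norm// ler_pdivlMr//.
    apply: le_trans; rewrite -mulrA ler_pM2l// mulrC.
    exact: Ncl.
have h3 : q * d <= d by rewrite ler_piMl// ltW.
have : e / cu = d + d by rewrite /d; lra.
by move=> ->; lra.
Qed.

End Volterra.

(** The solutions are the fixed points of F x = zeta + vintegral (A x), which is
    a contraction by [weighted_vint_le] applied to differences. *)
Lemma Volterra_C0_unique_solution {R : realType} {n : nat}
    (N : 'cV[R]_n -> R) (A : R -> 'M[R]_n) (nu : R -> R) :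
  is_norm N -> measurable_mx A -> bounded_mx N A ->
  (forall t, 0 < nu t) -> {homo nu : s t / s <= t >-> t <= s} ->
  (forall e, 0 < e -> exists T, forall t, T <= t -> nu t <= e) ->
  (weighted_sup N nu A < 1%:E)%E ->
  forall zeta, C0 nu zeta -> exists x, [/\ C0 nu x, solves A zeta x
    & forall y, C0 nu y -> solves A zeta y ->
        forall t, Rplus R t -> y t = x t].
Proof.
move=> hN mA bA nu_gt0 nu_ni nu_0 sup1 zeta Cz.
(* The contraction constant must be positive, hence the maximum with 1 / 2. *)
have [q [q01 supq]] : exists q, 0 < q < 1 /\ (weighted_sup N nu A <= q%:E)%E.
  move: sup1; case: (weighted_sup N nu A) => [r| |]//.
    rewrite lte_fin => r1; exists (Num.max r (1 / 2)); split.
      by rewrite lt_max gt_max r1/=; apply/andP; split; [apply/orP; right|]; lra.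
    by rewrite lee_fin le_max lexx.
  by move=> _; exists (1 / 2); split; [lra|rewrite leNye].
have q01w : 0 <= q <= 1 by case/andP: q01 => /ltW-> /ltW->.
pose F x t := zeta t + vintegral (fun s => A s *m x s) t.
have solvesF x : solves A zeta x <-> forall t, 0 <= t -> x t = F x t.
  split=> xF t; [rewrite -RplusE|rewrite RplusE] => t0; rewrite ?/F (xF t)//.
    by rewrite subrK.
  by rewrite /F addrK.
have [|x y C Cx Cy C_gt0 xyC t t0|x [Cx xF xuniq]] :=
  weighted_contraction_fixpoint (F := F) hN nu_gt0 nu_ni q01 Cz.
- move=> x Cx; apply: C0D => //; exact: (C0_vintegral hN mA bA nu_gt0 supq).
- have lx := C0_loc_bounded_measurable Cx.
  have ly := C0_loc_bounded_measurable Cy.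
  rewrite /F opprD addrACA subrr add0r -(vintegral_mulmxB hN mA bA)//.
  have := weighted_vint_le hN mA bA nu_gt0 supq (loc_bounded_measurableB lx ly)
    (leb_measurable_itv `[0, t]) (@subset_refl _ _) t0 C_gt0.
  by apply=> s /=; rewrite in_itv/= => /andP[s0 _]; exact: xyC.
exists x; split => //; first exact/solvesF.
move=> y Cy /solvesF yF t; rewrite RplusE; exact: xuniq.
Qed.

(** * The exponential weight *)

Section ExpWeight.
Context {R : realType} (a : R) (a0 : 0 < a).

Lemma exp_weight_gt0 t : 0 < exp_weight a t.
Proof. exact: expR_gt0. Qed.

Lemma exp_weight_ni : {homo exp_weight a : s t / s <= t >-> t <= s}.
Proof. by move=> s t st; rewrite /exp_weight ler_expR lerN2 ler_pM2l. Qed.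

Lemma exp_weight_small e : 0 < e ->
  exists T, forall t, T <= t -> exp_weight a t <= e.
Proof.
move=> e0; exists (e^-1 / a) => t et.
rewrite /exp_weight expRN -[leRHS]invrK lef_pV2 ?posrE ?expR_gt0 ?invr_gt0//.
apply: le_trans (expR_ge1Dx _); move: et; rewrite ler_pdivrMr// => et.
by rewrite mulrC; lra.
Qed.

End ExpWeight.

Section ExpIntegral.
Context {R : realType}.
Local Notation lebT := (lebesgueType R).

(** For Borel functions the two Lebesgue measures give the same integral: the
    Borel measure is the image of the completed one under the identity.  This
    makes the fundamental theorem of calculus usable for [leb]. *)
Lemma ge0_integral_leb (f : R -> \bar R) (D : set R) :
  measurable (D : set (measurableTypeR R)) ->
  measurable_fun (D : set (measurableTypeR R)) f ->
  (forall x, D x -> (0 <= f x)%E) ->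
  (\int[leb]_(x in (D : set lebT)) f x =
   \int[lebesgue_measure]_(x in D) f x)%E.
Proof.
move=> mD mf f0.
have := @ge0_integral_pushforward _ _ lebT (measurableTypeR R) R
  (id : lebT -> measurableTypeR R) measurable_id_leb leb D f mD mf.
rewrite preimage_id => <-; last by move=> x /set_mem; exact: f0.
apply: (eq_measure_integral lebesgue_measure); first exact: measurable_id_leb.
by move=> X mX XD; rewrite /= /pushforward preimage_id.
Qed.

Lemma exp_weight_ratioE (a t s : R) :
  exp_weight a t / exp_weight a s = exp_weight a t * expR (a * s).
Proof. by rewrite /exp_weight [expR (- (a * s))]expRN invrK. Qed.

Lemma exp_weight_ratio_continuous (a m t : R) :
  continuous (fun s => exp_weight a t / exp_weight a s * m).
Proof.
under eq_fun do rewrite exp_weight_ratioE.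
move=> s; apply: cvgM; last exact: cvg_cst.
apply: cvgM; first exact: cvg_cst.
apply: continuous_comp; last exact: continuous_expR.
by apply: cvgM; [exact: cvg_cst|exact: cvg_id].
Qed.

(** The integral is (m / a) (1 - exp_weight a t), by the fundamental theorem of
    calculus. *)
Lemma integral_exp_weight_le (a m t : R) : 0 < a -> 0 <= m -> 0 <= t ->
  (\int[leb]_(s in (`[0%R, t]%classic : set lebT))
     (exp_weight a t / exp_weight a s * m)%:E <= (m / a)%:E)%E.
Proof.
move=> a0 m0 t0.
pose F s : R := exp_weight a t * m / a * expR (a * s).
have dF (s : R) : is_derive s 1 F (exp_weight a t / exp_weight a s * m).
  apply: is_derive_eq.
  by rewrite exp_weight_ratioE /GRing.scale /=; field; lra.
have cf := @exp_weight_ratio_continuous a m t.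
have cF : continuous F.
  by move=> s; apply: differentiable_continuous; apply/derivable1_diffP; case: (dF s).
rewrite ge0_integral_leb; first last.
- by move=> s _; rewrite lee_fin mulr_ge0// divr_ge0 ?expR_ge0.
- apply/measurable_EFinP; apply: measurable_funTS.
  exact: measurable_realfun.continuous_measurable_fun.
- exact: measurable_itv.
have [->|tn0] := eqVneq t 0.
  by rewrite set_itv1 integral_set1 lee_fin divr_ge0// ltW.
have tp : 0 < t by rewrite lt_neqAle eq_sym tn0.
rewrite (@continuous_FTC2 R _ F)//.
- have nuK : exp_weight a t * expR (a * t) = 1.
    by rewrite /exp_weight -expRD addNr expR0.
  have FE : F t - F 0 = exp_weight a t * expR (a * t) * (m / a)
      - exp_weight a t * (m / a).
    by rewrite /F mulr0 expR0; ring.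
  rewrite -EFinB lee_fin FE nuK mul1r gerBl mulr_ge0 ?expR_ge0//.
  by rewrite divr_ge0// ltW.
- exact: continuous_subspaceT.
- split; first by move=> s _; case: (dF s).
  + exact/cvg_at_right_filter/cF.
  + exact/cvg_at_left_filter/cF.
- by move=> s _; rewrite derive1E; case: (dF s).
Qed.

End ExpIntegral.

(** If ||A s|| <= m almost everywhere on Rplus, then all the weighted integrals
    are at most m / a.  A real m >= 0 is first chosen between the essential
    supremum, an extended real, and a. *)
Lemma weighted_sup_lt1 {R : realType} {n : nat} (N : 'cV[R]_n -> R)
    (A : R -> 'M[R]_n) (a : R) : is_norm N -> 0 < a ->
  (Linfty_norm N A < a%:E)%E ->
  (weighted_sup N (exp_weight a) A < 1%:E)%E.
Proof.
move=> hN a0 Aa.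
have [m [m0 ma Am]] : exists m, [/\ 0 <= m, m < a & (Linfty_norm N A <= m%:E)%E].
  move: Aa; case: (Linfty_norm N A) => [r| |]//.
    rewrite lte_fin => ra; exists (Num.max 0 r); split.
    - by rewrite le_max lexx.
    - by rewrite gt_max a0.
    - by rewrite lee_fin le_max lexx orbT.
  by move=> _; exists 0; rewrite lexx leNye.
apply: (@le_lt_trans _ _ (m / a)%:E); last by rewrite lte_fin ltr_pdivrMr// mul1r.
apply: ge_ereal_sup => _ [t + <-]; rewrite RplusE => t0.
apply: le_trans (integral_exp_weight_le a0 m0 t0).
apply: le_integral_dominated_ae.
- exact: leb_measurable_itv.
- apply/measurable_EFinP.
  have mR : measurable (Rplus R : set (lebesgueType R)).
    exact: leb_measurable_itv.
  apply: (measurable_funS mR); last first.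
    apply: continuous_leb_measurable; apply: continuous_subspaceT.
    exact: exp_weight_ratio_continuous.
  by move=> s /=; rewrite in_itv/= RplusE => /andP[].
- by move=> s _; rewrite lee_fin mulr_ge0// divr_ge0 ?expR_ge0.
- have := ess_sup_ge leb ((fun s : lebesgueType R => (opnorm N (A s))%:E) \_
    (Rplus R : set (lebesgueType R))).
  apply: filterS => s sA /=; rewrite in_itv/= => /andP[s0 _].
  have Rs : Rplus R s by rewrite RplusE.
  rewrite lee_fin ler_wpM2l ?divr_ge0 ?expR_ge0//.
  rewrite -lee_fin; apply: le_trans Am; move: sA; rewrite patchE.
  by rewrite mem_set.
Qed.

Theorem lemma1p2 (R : realType) (n : nat) (N : 'cV[R]_n -> R)
    (A : R -> 'M[R]_n) (a : R) :
  is_norm N -> measurable_mx A -> bounded_mx N A -> 0 < a ->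
  ((Linfty_norm N A < a%:E)%E ->
     (weighted_sup N (exp_weight a) A < 1%:E)%E) /\
  ((weighted_sup N (exp_weight a) A < 1%:E)%E ->
     forall zeta : R -> 'cV[R]_n, C0 (exp_weight a) zeta ->
     exists x : R -> 'cV[R]_n,
       [/\ C0 (exp_weight a) x,
           solves A zeta x
         & forall y : R -> 'cV[R]_n, C0 (exp_weight a) y -> solves A zeta y ->
             forall t : R, Rplus R t -> y t = x t]).
Proof.
move=> hN mA bA a0; split; first exact: weighted_sup_lt1.
apply: Volterra_C0_unique_solution hN mA bA _ _ _.
- exact: exp_weight_gt0.
- exact: exp_weight_ni.
- exact: exp_weight_small.
Qed.
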